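(* Let $(R,+,* )$ be a ring with identity and group of units $U$ such that $|U|\ge 2$. Then the following are equivalent: (a) $R$ is a field; (b) $R$ is an a-near-ring with DCCL; (c) $R$ is an f-near-ring with DCCL.
   Context: A ring is in particular a near-ring. For a ring $R$ with identity $1$, $U$ is the group of multiplicatively invertible elements (units), and for $u\in R$ let $\psi_u:R\to R$, $n\mapsto n*u$, be right translation by $u$; it is an automorphism of $(R,+)$ when $u\in U$. A ring $R$ with identity is an f-near-ring if $\{\psi_u\mid u\in U\}$ acts as a fixed point free automorphism group on $(R,+)$, i.e. for every unit $u$ with $\psi_u\neq\mathrm{id}$, the only $n\in R$ with $n*u=n$ is $n=0$. A ring $R$ with identity is an a-near-ring if $U\cup\{0\}$ forms a subnear-field of $R$ with respect to the operations of $R$ (a near-field is a near-ring whose non-zero elements are all units, forming a group under multiplication). DCCL is the descending chain condition on left ideals.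
   Formalization: In (a), ''field'' is read as a not necessarily commutative field (skew field); with commutativity the claim fails, since the real quaternions satisfy (b) and (c) but are not commutative. *)

(* Defs.v *)
From mathcomp Require Import all_boot all_algebra.
From mathcomp Require Import classical_sets.

Set Implicit Arguments.
Unset Strict Implicit.
Unset Printing Implicit Defensive.

Import GRing.Theory.
Local Open Scope ring_scope.
Local Open Scope classical_set_scope.

(* Rings are associative with 1, not necessarily commutative; [pzRingType]
   does not exclude the zero ring and carries no unit structure (unlike
   [unitRingType]), hence the explicit set of two-sided units. *)
Definition units (R : pzRingType) : set R :=
  [set u | exists v, v * u = 1 /\ u * v = 1].

Definition psi (R : pzRingType) (u : R) : R -> R := fun n => n * u.

(* "Field" is not required to be commutative: the real quaternions are an
   a-near-ring and an f-near-ring with DCCL, so the equivalence fails if (a)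
   demands commutativity. For finite R both readings agree (Wedderburn). *)
Definition is_skew_field (R : pzRingType) : Prop :=
  1 != 0 :> R /\ forall x : R, x != 0 -> units x.

(* For rings, a fixed point of [psi u] is an element [n] with [n * u = n];
   [psi u] is automatically an automorphism of (R, +) when [u] is a unit. *)
Definition is_f_near_ring (R : pzRingType) : Prop :=
  forall u : R, units u -> ~ (psi u =1 id) ->
  forall n : R, psi u n = n -> n = 0.

Definition is_subnear_ring (R : pzRingType) (S : set R) : Prop :=
  [/\ S 0, forall x y, S x -> S y -> S (x - y)
    & forall x y, S x -> S y -> S (x * y)].

(* Associativity is inherited from R; the identity [e] is a priori not 1. *)
Definition is_mul_group (R : pzRingType) (G : set R) : Prop :=
  (forall x y, G x -> G y -> G (x * y)) /\
  exists e, [/\ G e, forall x, G x -> e * x = x /\ x * e = x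
              & forall x, G x -> exists y, [/\ G y, y * x = e & x * y = e]].

(* The remaining near-ring axioms are equations, hence inherited from R. *)
Definition is_subnear_field (R : pzRingType) (S : set R) : Prop :=
  is_subnear_ring S /\ is_mul_group (S `\ 0).

Definition is_a_near_ring (R : pzRingType) : Prop :=
  is_subnear_field (units (R := R) `|` [set 0]).

Definition is_left_ideal (R : pzRingType) (L : set R) : Prop :=
  [/\ L 0, forall x y, L x -> L y -> L (x - y)
    & forall a x, L x -> L (a * x)].

Definition dccl (R : pzRingType) : Prop :=
  forall L : nat -> set R,
    (forall n, is_left_ideal (L n)) -> (forall n, L n.+1 `<=` L n) ->
    exists N, forall n, (N <= n)%N -> L n = L N.

(* Main.v *)
(** The implication from f-near-ring with DCCL to skew field. If n^2 = 0, then
    1 + n is a unit whose right translation fixes n, so n = 0: R is reduced,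
    and its idempotents are therefore central. If e <> 1 is idempotent and u is
    a unit, then u e + (1 - e) is a unit whose right translation fixes
    1 - e <> 0, so u e = e; applied to e and to 1 - e, this shows that a
    nontrivial e would force u = 1 for all units. Finally, DCCL makes the chain
    of the R x^n stationary, and reducedness improves x^n = r x^(n+1) to
    x = r x x = x r x, so that r x and x r are idempotents, hence equal to 1
    when x <> 0. *)
Require Import Defs.
From mathcomp Require Import all_boot all_algebra.
From mathcomp Require Import boolp classical_sets.

Local Open Scope ring_scope.

Import GRing.Theory.

Set Implicit Arguments.
Unset Strict Implicit.

Lemma units1 (R : pzRingType) : units (1 : R).
Proof. by exists 1; rewrite mulr1. Qed.

Lemma unitsM (R : pzRingType) (u v : R) : units u -> units v -> units (u * v).
Proof.
move=> [u' [u'u uu']] [v' [v'v vv']]; exists (v' * u'); split.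
  by rewrite mulrA -(mulrA v') u'u mulr1.
by rewrite mulrA -(mulrA u) vv' mulr1.
Qed.

Lemma units_neq0 (R : pzRingType) (u : R) : 1 != 0 :> R -> units u -> u != 0.
Proof.
by move=> R10 [v [vu _]]; apply: contra_neq R10 => u0; rewrite -vu u0 mulr0.
Qed.

Lemma distinct_nontrivial (R : pzRingType) (u v : R) : u != v -> 1 != 0 :> R.
Proof.
by apply: contra_neq => R10; rewrite -[u]mulr1 -[v]mulr1 R10 !mulr0.
Qed.

Lemma left_ideal_unit_full (R : pzRingType) (L : set R) (x y : R) :
  is_left_ideal L -> L x -> units x -> L y.
Proof.
by move=> [_ _ LM] Lx [v [vx _]]; rewrite -[y]mulr1 -vx mulrA; apply: LM.
Qed.

Lemma is_left_ideal_principal (R : pzRingType) (x : R) :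
  is_left_ideal [set y | exists s, y = s * x].
Proof.
split=> [|_ _ [s ->] [t ->]|a _ [s ->]]; first by exists 0; rewrite mul0r.
  by exists (s - t); rewrite mulrBl.
by exists (a * s); rewrite mulrA.
Qed.

(** Here U together with 0 is all of R, so closure is free and only the group structure on the units
    needs an argument. *)
Lemma skew_field_a_near_ring (R : pzRingType) :
  is_skew_field R -> is_a_near_ring R.
Proof.
move=> [R10 Runit].
have ST x : (units (R := R) `|` [set 0])%classic x.
  by have [->|/Runit] := eqVneq x 0; [right | left].
have GP x : ((units (R := R) `|` [set 0]) `\ 0)%classic x <-> units x.
  split=> [[[//|-> []//]]|xU]; split; first by left.
  by apply/eqP/units_neq0.
split; split=> //.
  by move=> x y /GP xU /GP yU; apply/GP/unitsM.
exists 1; split; first exact/GP/units1.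
  by move=> x _; rewrite mul1r mulr1.
by move=> x /GP [y [yx xy]]; exists y; split=> //; apply/GP; exists x.
Qed.

(** A left ideal with a nonzero element contains a unit, hence is R. So the chain either reaches 0
    and stays there, or is constantly R. *)
Lemma skew_field_dccl (R : pzRingType) : is_skew_field R -> dccl R.
Proof.
move=> [_ Runit] L Lid Ldec.
have Lmono m n : (m <= n)%N -> (L n `<=` L m)%classic.
  move=> /subnK <-; elim: (n - m)%N => [|k IHk] x //.
  by rewrite addSn => /Ldec /IHk.
have [[N LN0]|Lnz] := pselect (exists N, forall x, L N x -> x = 0).
  exists N => n leNn; apply/seteqP; split; first exact: Lmono.
  by move=> x /LN0 ->; case: (Lid n).
have LT n x : L n x.
  apply: contrapT => nLx; apply: Lnz; exists n => y Ly.
  have [//|/Runit yU] := eqVneq y 0.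
  by case: nLx; apply: left_ideal_unit_full (Lid n) Ly yU.
by exists 0 => n _; apply/seteqP; split=> x _; apply: LT.
Qed.

(** Closure under subtraction puts [u - 1] in U or makes it 0. If it is a unit, [n * (u - 1) = 0]
    forces [n = 0]; if it is 0, [psi u] is the identity. *)
Lemma a_near_ring_f_near_ring (R : pzRingType) :
  is_a_near_ring R -> is_f_near_ring R.
Proof.
move=> [[_ SB _] _] u uU psi_u n /eqP; rewrite /psi -subr_eq0 => /eqP nu.
have [||[v [_ uv]]|/eqP] := SB u 1; first by left.
- by left; apply: units1.
- by rewrite -[n]mulr1 -uv mulrA mulrBr mulr1 nu mul0r.
by rewrite subr_eq0 => /eqP u1; case: psi_u => x; rewrite /psi u1 mulr1.
Qed.

Lemma f_near_ring_fixed (R : pzRingType) (u n : R) :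
  is_f_near_ring R -> units u -> u != 1 -> n * u = n -> n = 0.
Proof.
(* Evaluating at 1 separates [psi u] from the identity. *)
move=> fR uU /eqP u1; apply: fR uU _ n => /(_ 1).
by rewrite /psi mul1r.
Qed.

Definition reduced (R : pzRingType) := forall x : R, x * x = 0 -> x = 0.

Lemma f_near_ring_reduced (R : pzRingType) : is_f_near_ring R -> reduced R.
Proof.
move=> fR n nn; have [//|n0] := eqVneq n 0.
apply: (@f_near_ring_fixed _ (1 + n)) fR _ _ _.
- by exists (1 - n); rewrite !(mulrDl, mulrDr, mulNr, mulrN) nn !mul1r !mulr1
    oppr0 !addr0 subrK addrK.
- by apply: contra_neq n0 => n1; rewrite -[n](addKr 1) n1 addNr.
by rewrite mulrDr mulr1 nn addr0.
Qed.

Section Reduced.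
Variable R : pzRingType.
Hypothesis redR : reduced R.
Implicit Types a e x : R.

Lemma reduced_mul_eq0C a b : a * b = 0 -> b * a = 0.
Proof. by move=> ab; apply: redR; rewrite mulrA -(mulrA b) ab mulr0 mul0r. Qed.

(** One factor is cancelled at a time: for [y = a * x ^+ n.+1], [y * x = 0] gives [x * y = 0], hence
    [y * y = a * x ^+ n * (x * y) = 0]. *)
Lemma reduced_mulX_eq0 a x n : a * x ^+ n.+1 = 0 -> a * x = 0.
Proof.
elim: n => [//|n IHn]; rewrite exprSr mulrA => /reduced_mul_eq0C xax.
by apply/IHn/redR; rewrite {1}exprSr !mulrA -2!(mulrA (a * _)) -(mulrA x) xax mulr0.
Qed.

(** Both [e * x * (1 - e)] and [(1 - e) * x * e] square to 0, so [e * x] and [x * e] both equal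
    [e * x * e]. *)
Lemma reduced_idem_central e x : e * e = e -> e * x = x * e.
Proof.
move=> ee; have /reduced_mul_eq0C e1e : e * (1 - e) = 0.
  by rewrite mulrBr mulr1 ee subrr.
have /eqP : e * x * (1 - e) = 0.
  by apply: redR; rewrite -!mulrA (mulrA (1 - e)) e1e mul0r !mulr0.
have /eqP : (1 - e) * x * e = 0.
  by apply: redR; rewrite -!mulrA (mulrA e (1 - e)) mulrBr mulr1 ee subrr
    mul0r !mulr0.
by rewrite mulrBr mulrBl mulr1 mulrBl mul1r !subr_eq0 => /eqP -> /eqP.
Qed.

End Reduced.

Lemma f_near_ring_unit_idem (R : pzRingType) (u e : R) :
  is_f_near_ring R -> units u -> e * e = e -> e != 1 -> u * e = e.
Proof.
move=> fR [v [vu uv]] ee e1.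
have eC x : e * x = x * e.
  by apply: reduced_idem_central ee; apply: f_near_ring_reduced.
have [f Ef] : exists f, f = 1 - e by exists (1 - e).
have ef : e * f = 0 by rewrite Ef mulrBr mulr1 ee subrr.
have fe : f * e = 0 by rewrite -eC.
have ff : f * f = f by rewrite [X in X * _]Ef mulrBl mul1r ef subr0.
(* As [e] is central and orthogonal to [f], the product is [a * b * e + f]. Used in both orders,
   this makes [v * e + f] a two-sided inverse of [u * e + f]. *)
have glue a b : a * b = 1 -> (a * e + f) * (b * e + f) = 1.
  move=> ab; rewrite mulrDl !mulrDr ff -[a * e * f]mulrA ef mulr0 addr0.
  rewrite -[b * e]eC [f * _]mulrA fe mul0r add0r -mulrA [e * _]mulrA ee eC.
  by rewrite mulrA ab mul1r Ef addrC subrK.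
have [|w1] := eqVneq (u * e + f) 1.
  by rewrite Ef => /(canRL (addrK _)); rewrite opprB addrC subrK.
have f0 : f = 0.
  apply: f_near_ring_fixed fR _ w1 _.
    by exists (v * e + f); split; apply: glue.
  by rewrite mulrDr ff -eC mulrA fe mul0r add0r.
by move/eqP: Ef e1; rewrite f0 eq_sym subr_eq0 eq_sym => ->.
Qed.

Lemma f_near_ring_idem (R : pzRingType) (u e : R) :
  is_f_near_ring R -> units u -> u != 1 -> e * e = e -> e != 0 -> e = 1.
Proof.
move=> fR uU u1 ee e0; apply: contra_neq_eq u1 => e1.
have /(f_near_ring_unit_idem fR uU) ue' : (1 - e) * (1 - e) = 1 - e.
  by rewrite mulrBl mul1r mulrBr mulr1 ee subrr subr0.
have ue := f_near_ring_unit_idem fR uU ee e1.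
rewrite -[u]mulr1 -[X in u * X](subrK e) mulrDr ue ue' ?subrK //.
by apply: contra_neq e0 => /eqP; rewrite subr_eq addrC -subr_eq subrr eq_sym => /eqP.
Qed.

Lemma dccl_strongly_pi_regular (R : pzRingType) (x : R) :
  dccl R -> exists n r, x ^+ n = r * x ^+ n.+1.
Proof.
move=> /(_ (fun n => [set y | exists s, y = s * x ^+ n]%classic)) [||N LN].
- by move=> n; apply: is_left_ideal_principal.
- by move=> n _ [s ->]; exists (s * x); rewrite exprS mulrA.
have : [set y | exists s, y = s * x ^+ N]%classic (x ^+ N).
  by exists 1; rewrite mul1r.
by rewrite -(LN N.+1 (leqnSn N)) => -[r xr]; exists N, r.
Qed.

Lemma f_near_ring_dccl_skew_field (R : pzRingType) (u : R) :
  is_f_near_ring R -> units u -> u != 1 -> dccl R -> is_skew_field R.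
Proof.
move=> fR uU u1 dR; have redR := f_near_ring_reduced fR.
split=> [|x x0]; first exact: distinct_nontrivial u1.
have [n [r xn]] := dccl_strongly_pi_regular x dR.
(* Already [(1 - r * x) * x ^+ n = 0]; since [n] may be 0, one more factor [x] is multiplied in
   before the power is cancelled down to [x]. *)
have /(reduced_mul_eq0C redR)/eqP : (1 - r * x) * x = 0.
  apply: (reduced_mulX_eq0 redR (n := n)).
  by rewrite exprSr mulrA mulrBl mul1r -mulrA -exprS -xn subrr mul0r.
rewrite mulrBr mulr1 subr_eq0 mulrA => /eqP xrx.
exists r; split; apply: (f_near_ring_idem fR uU u1).
- by rewrite -mulrA (mulrA x) -xrx.
- by apply: contra_neq x0 => rx0; rewrite xrx -mulrA rx0 mulr0.
- by rewrite mulrA -xrx.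
- by apply: contra_neq x0 => xr0; rewrite xrx xr0 mul0r.
Qed.

Theorem theorem3p1 (R : pzRingType)
    (hU : exists u v : R, [/\ units u, units v & u != v]) :
  [<-> is_skew_field R;
       is_a_near_ring R /\ dccl R;
       is_f_near_ring R /\ dccl R].
Proof.
tfae.
- by move=> sR; split; [apply: skew_field_a_near_ring | apply: skew_field_dccl].
- by move=> [aR dR]; split=> //; apply: a_near_ring_f_near_ring.
move=> [fR dR]; have [w wU w1] : exists2 w : R, units w & w != 1.
  have [u [v [uU vU uv]]] := hU; have [u1|] := eqVneq u 1; last by exists u.
  by exists v => //; rewrite eq_sym -u1.
exact: f_near_ring_dccl_skew_field fR wU w1 dR.
Qed.
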